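(* Let $S$ be a uniformly based $\mathrm{Cu}$-semigroup and let $\mathcal{B}:=(\Lambda_n,\epsilon_n)_n$ and $\mathcal{B}':=(\Lambda'_n,\epsilon'_n)_n$ be two finite uniform bases of $S$. Let $T$ be a $\mathrm{Cu}$-semigroup and let $\alpha:S\to T$ be a $\mathrm{Cu}$-morphism. Then for any $n\in\mathbb{N}$ with $n\ge1$, $$B_{r''_n}(\alpha,dd_{\mathrm{Cu},\mathcal{B}})\subseteq B_{1/n}(\alpha,dd_{\mathrm{Cu},\mathcal{B}'})\quad\text{and}\quad B_{1/n}(\alpha,dd_{\mathrm{Cu},\mathcal{B}'})\subseteq B_{r'_n}(\alpha,dd_{\mathrm{Cu},\mathcal{B}}),$$ where $r'_n:=1/q_{B'B}(n)$ and $r''_n$ is such that ${r''_n}^{-1}\in q_{BB'}^{-1}(\{m\in\mathbb{N}: m\ge n\})$.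
   Context: $\mathbb{N}$ contains $0$. A positively ordered monoid (PoM) is a commutative monoid with a translation-invariant partial order $\le$ for which $0$ is the least element; a PoM-morphism is an order-preserving monoid homomorphism. In a PoM $S$, $x\ll y$ means: for every increasing sequence $(z_n)_n$ having a supremum with $\sup_n z_n\ge y$ there is $k$ with $x\le z_k$. A $\mathrm{Cu}$-semigroup is a PoM such that: (O1) every increasing sequence has a supremum; (O2) every element is the supremum of a $\ll$-increasing sequence; (O3) $x'\ll x$, $y'\ll y$ imply $x'+y'\ll x+y$; (O4) addition commutes with suprema of increasing sequences. A $\mathrm{Cu}$-morphism is a PoM-morphism preserving $\ll$ and suprema of increasing sequences. Let $S_\ll=\{s: \exists t\in S,\ s\ll t\}$ and $s_\ll=\{s': s'\ll s\}$. A uniform basis of $S$ is a countable family $(M_n,\epsilon_n)_{n\in\mathbb{N}}$, where $M_n$ is a PoM contained in $S_\ll$ and $\epsilon_n:S_\ll\to M_n$ is order-preserving and super-additive ($\epsilon_n(g)+\epsilon_n(h)\le\epsilon_n(g+h)$), such that: (U1) $(M_n)_n$ is $\subseteq$-increasing (convention $M_{-2}=M_{-1}=M_0=\{0\}$); (U2) the restriction of $\epsilon_n$ to $\bigcup_{l<n-1}M_l$ is a PoM-morphism; (U3) for every $s\in S_\ll$, $(\epsilon_n(s))_n$ is increasing in $s_\ll$ with supremum $s$; (U4) $(\epsilon_n(s))_{n>l}$ is $\ll$-increasing whenever $s\in M_l$. Chain-generating sets. A subset $\Lambda\subseteq S_\ll$ is a chain-generating set of the $\mathrm{Cu}$-semigroup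 $S$ if (i) for countable descending chains $(s_n)_n,(t_n)_n$ in $\Lambda$, $\sum_n s_n\le\sum_n t_n$ iff $s_n\le t_n$ for all $n$; (ii) every $s\in S$ is $\sum_{n=0}^\infty s_n$ (supremum of partial sums) for some countable descending chain $(s_n)_n$ in $\Lambda$. A (proper) subset $\Lambda$ of a PoM $M$ is a chain-generating set of $M$ if the same holds with finite descending chains (chains being padded by zeros when compared). If $S$ has a uniform basis $(M_n,\epsilon_n)_n$ and a chain-generating set $\Lambda$ such that $\Lambda_n:=\Lambda\cap M_n$ is a finite chain-generating set of $M_n$ for every $n$, then $(\Lambda_n,\epsilon_n)_n$ is called a finite uniform basis of $S$. For $\mathrm{Cu}$-morphisms $\alpha,\beta:S\to T$ and $\Lambda\subseteq S$, write $\alpha\underset{\Lambda}{\simeq}\beta$ if for all $g',g\in\Lambda$ with $g'\ll g$ one has $\alpha(g')\le\beta(g)$ and $\beta(g')\le\alpha(g)$. Define $dd_{\mathrm{Cu},\mathcal{B}}(\alpha,\beta):=\inf\{\frac1n: \alpha\underset{\Lambda_n}{\simeq}\beta\}$ (over $n\ge1$; value $\infty$ if there is no such $n$). $B_r(\alpha,d)$ is the (closed) ball $\{\beta\in\mathrm{Hom}_{\mathrm{Cu}}(S,T): d(\alpha,\beta)\le r\}$, with $1/0=\infty$. For two finite uniform bases $\mathcal{B}=(\Lambda_n,\epsilon_n)_n$, $\mathcal{B}'=(\Lambda'_n,\epsilon'_n)_n$ let $p_{B'B}(n)$ be the minimal $p\in\mathbb{N}$ such that for all $g',g\in\Lambda_n$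 with $g'\ll g$ there are $h',h\in\Lambda'_p$ with $g'\ll h'\ll h\ll g$ (such $p$ exists), and $q_{B'B}(m):=\max\, p_{B'B}^{-1}(\{0,\dots,m\})$. The maps $p_{BB'}$, $q_{BB'}$ are defined with the roles of $\mathcal{B}$ and $\mathcal{B}'$ exchanged. *)

(* Defs.v *)
From HB Require Import structures.
From mathcomp Require Import all_boot all_order all_algebra.
From mathcomp Require Import all_classical all_reals ereal sequences.

Set Implicit Arguments.
Unset Strict Implicit.
Unset Printing Implicit Defensive.

Import Order.TTheory GRing.Theory Num.Theory.

Local Open Scope classical_set_scope.
Local Open Scope order_scope.

(* The addition is a field of the structure, rather than inherited from
   [nmodType], because the only join of [porderType] with additive structures
   that the library admits is [porderZmodType]. *)
HB.mixin Record isPoM d S of Order.POrder d S := {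
  pom_zero : S ;
  pom_add : S -> S -> S ;
  pom_addA : associative pom_add ;
  pom_addC : commutative pom_add ;
  pom_add0 : left_id pom_zero pom_add ;
  pom_ge0 : forall x : S, pom_zero <= x ;
  pom_leD2r : forall z x y : S, x <= y -> pom_add x z <= pom_add y z
}.

#[short(type="pomType")]
HB.structure Definition PoM d := { S of isPoM d S & Order.POrder d S }.

Declare Scope pom_scope.
Delimit Scope pom_scope with pom.
Notation "0" := pom_zero : pom_scope.
Notation "x + y" := (pom_add x y) : pom_scope.
Notation "\sum_ ( i <- r ) F" :=
  (\big[pom_add/pom_zero]_(i <- r) F%pom) : pom_scope.
Notation "\sum_ ( m <= i < n ) F" :=
  (\big[pom_add/pom_zero]_(m <= i < n) F%pom) : pom_scope.
Local Open Scope pom_scope.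

HB.instance Definition _ d (S : pomType d) :=
  Monoid.isComLaw.Build S pom_zero pom_add pom_addA pom_addC pom_add0.

Definition way_below d (S : pomType d) (x y : S) : Prop :=
  forall (z : nat -> S) (s : S), nondecreasing_seq z ->
    supremums (range z) s -> y <= s -> exists k, x <= z k.

Notation "x '<<<' y" := (way_below x y) (at level 70, no associativity).

HB.mixin Record isCu d S of PoM d S := {
  cu_O1 : forall z : nat -> S, nondecreasing_seq z ->
    exists s, supremums (range z) s ;
  cu_O2 : forall s : S, exists2 z : nat -> S,
    (forall n, z n <<< z n.+1) & supremums (range z) s ;
  cu_O3 : forall x' x y' y : S,
    x' <<< x -> y' <<< y -> (x' + y') <<< (x + y) ;
  cu_O4 : forall (y z : nat -> S) (s t : S),
    nondecreasing_seq y -> nondecreasing_seq z ->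
    supremums (range y) s -> supremums (range z) t ->
    supremums (range (fun n => y n + z n)) (s + t)
}.

#[short(type="cuType")]
HB.structure Definition CuSemigroup d := { S of isCu d S & PoM d S }.

Definition pom_morphism_on d d' (S : pomType d) (T : pomType d')
    (A : set S) (f : S -> T) : Prop :=
  [/\ f 0 = 0,
      forall x y, A x -> A y -> f (x + y) = f x + f y &
      forall x y, A x -> A y -> x <= y -> f x <= f y].

Definition cu_morphism d d' (S : cuType d) (T : cuType d')
    (f : S -> T) : Prop :=
  [/\ pom_morphism_on [set: S] f,
      forall x y : S, x <<< y -> f x <<< f y &
      forall (z : nat -> S) (s : S), nondecreasing_seq z ->
        supremums (range z) s -> supremums (range (f \o z)) (f s)].

Record cuHom d d' (S : cuType d) (T : cuType d') := CuHom {
  cuHom_fun :> S -> T ;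
  cuHomP : cu_morphism cuHom_fun
}.

Definition waybelow_part d (S : pomType d) : set S :=
  [set s | exists t : S, s <<< t].
Arguments waybelow_part {d} S.

(* A sub-PoM is a submonoid with the induced order. *)
Definition submonoid d (S : pomType d) (M : set S) : Prop :=
  M 0 /\ forall x y, M x -> M y -> M (x + y).

(* The union of the [M l] over the integers [l < n - 1], where
   [M (-2) = M (-1) = {0}]; the negative indices matter only for [n <= 1]. *)
Definition lower_union d (S : pomType d) (M : nat -> set S) (n : nat)
    : set S :=
  [set x | x = 0 \/ exists2 l, (l.+1 < n)%N & M l x].

(* The maps [eps n : S_<< -> M n] are extended to all of [S]; only their values
   on [waybelow_part S] are constrained. *)
Record uniform_basis d (S : cuType d) (M : nat -> set S) (eps : nat -> S -> S)
    : Prop := {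
  ub_submonoid : forall n, submonoid (M n) ;
  ub_subset : forall n, M n `<=` waybelow_part S ;
  ub_codom : forall n s, waybelow_part S s -> M n (eps n s) ;
  ub_le : forall n g h, waybelow_part S g -> waybelow_part S h ->
    g <= h -> eps n g <= eps n h ;
  ub_superadd : forall n g h, waybelow_part S g -> waybelow_part S h ->
    eps n g + eps n h <= eps n (g + h) ;
  ub_M0 : M 0%N = [set 0] ;
  ub_U1 : forall n, M n `<=` M n.+1 ;
  ub_U2 : forall n, pom_morphism_on (lower_union M n) (eps n) ;
  ub_U3 : forall s, waybelow_part S s ->
    [/\ forall n, eps n s <<< s,
        nondecreasing_seq (fun n => eps n s) &
        supremums (range (fun n => eps n s)) s] ;
  ub_U4 : forall l s, M l s ->
    forall n, (l < n)%N -> eps n s <<< eps n.+1 s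
}.

Definition uniformly_based d (S : cuType d) : Prop :=
  exists (M : nat -> set S) (eps : nat -> S -> S), uniform_basis M eps.

Definition desc_chain d (S : pomType d) (L : set S) (s : nat -> S) : Prop :=
  nonincreasing_seq s /\ forall n, L (s n).

Definition is_inf_sum d (S : pomType d) (s : nat -> S) (x : S) : Prop :=
  supremums (range (fun n => \sum_(0 <= i < n) s i)) x.

(* By (O1) every sequence has a unique infinite sum, so the sums [x], [y] may be
   quantified over. *)
Definition chain_generating d (S : cuType d) (L : set S) : Prop :=
  [/\ L `<=` waybelow_part S,
      forall s t : nat -> S, desc_chain L s -> desc_chain L t ->
        forall x y, is_inf_sum s x -> is_inf_sum t y ->
        (x <= y <-> forall n, s n <= t n) &
      forall x : S, exists2 s, desc_chain L s & is_inf_sum s x].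

Definition fin_desc_chain d (S : pomType d) (L : set S) (s : seq S) : Prop :=
  sorted (fun x y : S => y <= x) s /\ forall x, x \in s -> L x.

(* [nth 0] pads the finite chains with zeros. [L] is not required to differ
   from [M]: in a finite uniform basis [M 0 = {0}] and the infinite chains force
   [0] into the chain-generating set. *)
Definition chain_generating_sub d (S : pomType d) (M L : set S) : Prop :=
  [/\ L `<=` M,
      forall s t : seq S, fin_desc_chain L s -> fin_desc_chain L t ->
        (\sum_(x <- s) x <= \sum_(x <- t) x
         <-> forall n, nth pom_zero s n <= nth pom_zero t n) &
      forall x, M x -> exists2 s, fin_desc_chain L s & x = \sum_(y <- s) y].

Record fin_uniform_basis d (S : cuType d) := FinUniformBasis {
  fub_M : nat -> set S ;
  fub_eps : nat -> S -> S ;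
  fub_gen : set S ;
  fub_uniform_basis : uniform_basis fub_M fub_eps ;
  fub_chain_generating : chain_generating fub_gen ;
  fub_finite : forall n, finite_set (fub_gen `&` fub_M n) ;
  fub_chain_generating_sub : forall n,
    chain_generating_sub (fub_M n) (fub_gen `&` fub_M n)
}.

Definition fub_Lambda d (S : cuType d) (B : fin_uniform_basis S) (n : nat)
    : set S :=
  fub_gen B `&` fub_M B n.

Definition cu_close d d' (S : cuType d) (T : cuType d')
    (L : set S) (a b : S -> T) : Prop :=
  forall g' g, L g' -> L g -> g' <<< g -> a g' <= b g /\ b g' <= a g.

(* [ereal_inf set0 = +oo]. *)
Definition ddCu (R : realType) d d' (S : cuType d) (T : cuType d')
    (B : fin_uniform_basis S) (a b : cuHom S T) : \bar R :=
  ereal_inf [set (n%:R^-1)%R%:E | n in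
    [set n : nat | (0 < n)%N /\ cu_close (fub_Lambda B n) a b]].

Definition closed_ball_Cu (R : realType) d d' (S : cuType d) (T : cuType d')
    (dist : cuHom S T -> cuHom S T -> \bar R) (a : cuHom S T) (r : \bar R)
    : set (cuHom S T) :=
  [set b | (dist a b <= r)%E].

Definition interpolates d (S : pomType d) (L L' : set S) : Prop :=
  forall g' g, L g' -> L g -> g' <<< g ->
    exists h' h, [/\ L' h', L' h, g' <<< h', h' <<< h & h <<< g].

(* [p_index B' B] is p_{B'B}, with value 0 if no [p] interpolates (which never
   happens for finite uniform bases of the same semigroup). *)
Definition p_index d (S : cuType d) (B' B : fin_uniform_basis S)
    (n : nat) : nat :=
  xget 0%N [set p |
    interpolates (fub_Lambda B n) (fub_Lambda B' p) /\
    forall p', interpolates (fub_Lambda B n) (fub_Lambda B' p') -> (p <= p')%N].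

(* [q_index R B' B] is q_{B'B}, the largest [n] such that
   [p_index B' B n <= m]; it is [+oo] when there are arbitrarily large such [n],
   which can happen as [p_index B' B] may be bounded. *)
Definition q_index (R : realType) d (S : cuType d) (B' B : fin_uniform_basis S)
    (m : nat) : \bar R :=
  ereal_sup [set n%:R%:E | n in [set n : nat | (p_index B' B n <= m)%N]].

(* Main.v *)
(** The two chain-generating sets coincide: uniqueness of chains forces a
    chain-generating set to be a lower set, and a chain summing to [g] in one
    set is then [g] followed by zeros in the other.  Hence [eps'_p g] lies in
    [Lambda'_p] for every [g] in [Lambda], and U3 together with (O2)
    interpolates [g' << g] by [eps'_p g << eps'_q g]; finiteness of [Lambda_n]
    makes [p_{B'B}(n)] well defined.  The ball of radius [1/k] consists of the
    morphisms that are close on [Lambda_k], and closeness on [Lambda'_p] passes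
    to [Lambda_n] as soon as [Lambda'_p] interpolates [Lambda_n]. *)
Require Import Defs.
From mathcomp Require Import all_boot all_order all_algebra.
From mathcomp Require Import all_classical all_reals ereal sequences.

Import Order.TTheory GRing.Theory Num.Theory.

Local Open Scope classical_set_scope.
Local Open Scope order_scope.

(** Serves to choose one index [p] for all pairs of the finite set [Lambda_n] at once. *)
Lemma finite_uniform_bound {T : eqType} (A : set T) (P : T -> nat -> Prop) :
  finite_set A -> (forall x m n, (m <= n)%N -> P x m -> P x n) ->
  (forall x, A x -> exists n, P x n) -> exists n, forall x, A x -> P x n.
Proof.
move=> /finite_seqP[s ->] Pmono; elim: s => [|x s IH] AP; first by exists 0%N.
have [|n Pn] := IH; first by move=> y ys; apply: AP => /=; rewrite inE ys orbT.
have [|m Pm] := AP x; first by rewrite /= mem_head.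
exists (maxn m n) => y /=; rewrite inE => /orP[/eqP->|ys].
  exact: Pmono (leq_maxl m n) Pm.
by apply: Pmono (leq_maxr m n) _; apply: Pn.
Qed.

(** * Way-below relation and infinite sums in a PoM *)

Section WayBelow.
Context {d : Order.disp_t} {S : pomType d}.
Implicit Types x y z : S.

Lemma way_below_le_trans x y z : x <<< y -> y <= z -> x <<< z.
Proof. by move=> xy yz u s ndu us zs; apply: xy ndu us _; apply: le_trans zs. Qed.

Lemma le_way_below_trans x y z : x <= y -> y <<< z -> x <<< z.
Proof.
move=> xy yz u s ndu us zs; have [k yk] := yz u s ndu us zs.
by exists k; apply: le_trans yk.
Qed.

Lemma way_belowW x y : x <<< y -> x <= y.
Proof.
move=> xy; have [|||_ xy'] := xy (fun=> y) y => //.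
by split=> [_ [_ _ <-]//|u]; apply; exists 0%N.
Qed.

Lemma way_below00 : (pom_zero : S) <<< pom_zero.
Proof. by move=> z s _ _ _; exists 0%N; apply: pom_ge0. Qed.

Lemma le0_pom x : x <= pom_zero -> x = pom_zero.
Proof. by move=> x0; apply/le_anti; rewrite x0 pom_ge0. Qed.

Lemma is_inf_sum_uniq (s : nat -> S) x y :
  is_inf_sum s x -> is_inf_sum s y -> x = y.
Proof. by move=> [sx xs] [sy ys]; apply/le_anti; rewrite xs//= ys. Qed.

Lemma is_inf_sum_head (s : nat -> S) :
  (forall n, s n.+1 = pom_zero) -> is_inf_sum s (s 0%N).
Proof.
move=> s0.
have sumE n : \big[pom_add/pom_zero]_(0 <= i < n.+1) s i = s 0%N.
  by rewrite big_nat_recl// big1 ?Monoid.mulm1// => i _; rewrite s0.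
split=> [_ [[|n] _ <-]|u]; last by apply; exists 1%N => //; rewrite sumE.
  by rewrite big_nil pom_ge0.
by rewrite sumE.
Qed.

End WayBelow.

(** * Chain-generating sets and interpolation between finite uniform bases *)

Section CuSemigroups.
Context {d : Order.disp_t} {S : cuType d}.
Implicit Types x y z g : S.

Lemma way_below_interpolate x y :
  x <<< y -> exists z, x <<< z /\ z <<< y.
Proof.
move=> xy; have [z zz zy] := cu_O2 y.
have ndz : nondecreasing_seq z.
  by apply/nondecreasing_seqP => n; apply/way_belowW/zz.
have [k xk] := xy z y ndz zy (lexx y).
(* The index [k.+1] leaves a strict step on each side: [x <= z k <<< z k.+1 <<< z k.+2 <= y]. *)
exists (z k.+1); split; first exact: le_way_below_trans xk (zz k).
by apply: way_below_le_trans (zz k.+1) _; apply: zy.1; exists k.+2.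
Qed.

(** The head of a chain in [L] summing to [0] is bounded by that sum, hence is [0]. *)
Lemma chain_generating0 {L : set S} : chain_generating L -> L pom_zero.
Proof.
move=> [_ _ /(_ pom_zero)[s [_ Ls] [s0 _]]].
rewrite -(le0_pom (s 0%N) _)//.
by apply: s0; exists 1%N => //; rewrite big_nat1.
Qed.

Definition single_chain g (n : nat) : S := if n is 0%N then g else pom_zero.

Lemma single_chainP (L : set S) g : L pom_zero -> L g ->
  desc_chain L (single_chain g) /\ is_inf_sum (single_chain g) g.
Proof.
move=> L0 Lg; split; last exact: (is_inf_sum_head (single_chain g)).
split=> [|[|n]//]; apply/nonincreasing_seqP => -[|n] //=.
exact: pom_ge0.
Qed.

(** Comparing a chain of [x] with [g, 0, 0, ...] kills every term after the head, so [x] is the head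
    of its own chain. *)
Lemma chain_generating_lower {L : set S} x g :
  chain_generating L -> L g -> x <= g -> L x.
Proof.
move=> cgL Lg xg; have L0 := chain_generating0 cgL.
case: cgL => _ cmpL /(_ x)[s Cs sx].
have [Ct tg] := single_chainP L g L0 Lg.
have /(cmpL s _ Cs Ct x g sx tg) st := xg.
rewrite (is_inf_sum_uniq s x (s 0%N) sx); first exact: Cs.2.
by apply: is_inf_sum_head => n; apply/le0_pom/(st n.+1).
Qed.

Lemma chain_generating_subset {L L' : set S} :
  chain_generating L -> chain_generating L' -> L `<=` L'.
Proof.
move=> cgL [_ _ gen] g Lg; have L0 := chain_generating0 cgL.
have [s [nis L's] sg] := gen g.
have Cs : desc_chain L s.
  (* The terms of [s] are at most its head, and the head is a partial sum, so all lie below [g] and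
     thus in [L]; [s] becomes comparable with [g, 0, 0, ...] inside [L]. *)
  split=> // n; apply: chain_generating_lower cgL Lg _.
  apply: le_trans (nis _ _ (leq0n n)) _; apply: sg.1; exists 1%N => //.
  by rewrite big_nat1.
have [Ct tg] := single_chainP L g L0 Lg.
case: cgL => _ cmpL _.
have st := (cmpL s _ Cs Ct g g sg tg).1 (lexx g).
have ts := (cmpL _ s Ct Cs g g tg sg).1 (lexx g).
by rewrite (_ : g = s 0%N)//; apply/le_anti; rewrite (ts 0%N) (st 0%N).
Qed.

Lemma fub_Lambda_homo (B : fin_uniform_basis S) m n :
  (m <= n)%N -> fub_Lambda B m `<=` fub_Lambda B n.
Proof.
move=> /subnK <-; elim: (n - m)%N => [//|k IH] x /IH[gx Mx].
by split=> //; apply: (ub_U1 (fub_uniform_basis B)).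
Qed.

Lemma fub_Lambda_eps (B : fin_uniform_basis S) n g :
  fub_gen B g -> fub_Lambda B n (fub_eps B n g).
Proof.
move=> Bg; have cgB := fub_chain_generating B.
have ub := fub_uniform_basis B.
have wg : waybelow_part S g by case: cgB => + _ _; apply.
split; last exact: (ub_codom ub).
apply: chain_generating_lower cgB Bg _.
by case: (ub_U3 ub wg) => /(_ n)/way_belowW.
Qed.

Lemma interpolates_pair (B' : fin_uniform_basis S) g' g :
  fub_gen B' g -> g' <<< g -> exists p h' h,
    [/\ fub_Lambda B' p h', fub_Lambda B' p h, g' <<< h', h' <<< h & h <<< g].
Proof.
move=> B'g g'g; have [+ _ _] := fub_chain_generating B'.
move=> /(_ _ B'g)/(ub_U3 (fub_uniform_basis B'))[epsg nd sup].
have eps_above x : x <<< g -> exists p, x <<< fub_eps B' p g.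
  move=> /way_below_interpolate[y [xy yg]].
  have [p yp] := yg _ _ nd sup (lexx g).
  by exists p; apply: way_below_le_trans yp.
have [p g'p] := eps_above _ g'g; have [q pq] := eps_above _ (epsg p).
(* Nothing orders [p] and [q], so the maximum provides a level containing both interpolants. *)
exists (maxn p q), (fub_eps B' p g), (fub_eps B' q g); split=> //.
  by apply: fub_Lambda_homo (leq_maxl p q) _ _; apply: fub_Lambda_eps.
by apply: fub_Lambda_homo (leq_maxr p q) _ _; apply: fub_Lambda_eps.
Qed.

Lemma interpolates_exists (B' B : fin_uniform_basis S) n :
  exists p, interpolates (fub_Lambda B n) (fub_Lambda B' p).
Proof.
have finL := fub_finite B n.
pose P (u : S * S) p := u.1 <<< u.2 -> exists h' h,
  [/\ fub_Lambda B' p h', fub_Lambda B' p h, u.1 <<< h', h' <<< h & h <<< u.2].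
have [|u m k mk Pm /Pm|[g' g] [_ [Bg _]]|p Pp] :=
    @finite_uniform_bound _ (fub_Lambda B n `*` fub_Lambda B n) P.
- exact: finite_setX.
- move=> [h' [h [h'm hm ? ? ?]]].
  by exists h', h; split=> //; apply: fub_Lambda_homo mk _ _.
- have [/= g'g|] := pselect (g' <<< g); last by exists 0%N.
  have [|p Pp] := interpolates_pair B' g' g _ g'g; last by exists p.
  exact: chain_generating_subset (fub_chain_generating B)
    (fub_chain_generating B') g Bg.
- by exists p => g' g Lg' Lg; apply: (Pp (g', g)).
Qed.

Lemma p_indexP (B' B : fin_uniform_basis S) n :
  interpolates (fub_Lambda B n) (fub_Lambda B' (p_index B' B n)) /\
  forall p, interpolates (fub_Lambda B n) (fub_Lambda B' p) ->
    (p_index B' B n <= p)%N.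
Proof.
have exP : exists p, `[< interpolates (fub_Lambda B n) (fub_Lambda B' p) >].
  by have [p /asboolP Ip] := interpolates_exists B' B n; exists p.
(* The case where [xget] returns its default is refuted by the least interpolating index. *)
rewrite /p_index; case: xgetP => [_ _ //|noP].
case: (ex_minnP exP) => p /asboolP Ip minp; case: (noP p).
by split=> // p' /asboolP/minp.
Qed.

(** Makes the set whose supremum is [q_index] nonempty, so that this supremum is not [-oo]. *)
Lemma p_index0 (B' B : fin_uniform_basis S) : p_index B' B 0 = 0%N.
Proof.
apply/eqP; rewrite -leqn0; apply: (p_indexP B' B 0).2 => g' g.
rewrite /fub_Lambda !(ub_M0 (fub_uniform_basis _)) => -[_ ->] [_ ->] _.
have L0 := chain_generating0 (fub_chain_generating B').
by exists pom_zero, pom_zero; split=> //; apply: way_below00.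
Qed.

End CuSemigroups.

(** * Transfer of closeness between bases *)

Section Closeness.
Context {d d' : Order.disp_t} {S : cuType d} {T : cuType d'}.
Implicit Types (a b : cuHom S T) (B : fin_uniform_basis S).

Lemma cuHom_le a x y : x <= y -> a x <= a y.
Proof. by case: (cuHomP a) => -[_ _ + _ _]; apply. Qed.

Lemma cuHom0 a : a pom_zero = pom_zero.
Proof. by case: (cuHomP a) => -[]. Qed.

Lemma cu_close_subset (L L' : set S) (a b : S -> T) :
  L `<=` L' -> cu_close L' a b -> cu_close L a b.
Proof. by move=> LL' ab g' g /LL' Lg' /LL' Lg; apply: ab. Qed.

(** Sandwich [a g' <= a h' <= b h <= b g], and the same with [a] and [b] exchanged. *)
Lemma cu_close_interpolates (L L' : set S) a b :
  interpolates L L' -> cu_close L' a b -> cu_close L a b.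
Proof.
move=> I ab g' g Lg' Lg g'g.
have [h' [h [L'h' L'h g'h' h'h hg]]] := I _ _ Lg' Lg g'g.
have [abh bah] := ab _ _ L'h' L'h h'h.
split; apply: le_trans (cuHom_le _ _ _ (way_belowW _ _ g'h')) _.
  exact/(le_trans abh)/cuHom_le/way_belowW.
exact/(le_trans bah)/cuHom_le/way_belowW.
Qed.

Lemma cu_close_p_index B' B a b n m :
  (p_index B' B n <= m)%N ->
  cu_close (fub_Lambda B' m) a b -> cu_close (fub_Lambda B n) a b.
Proof.
move=> pm ab; apply: cu_close_interpolates (p_indexP B' B n).1 _.
exact: cu_close_subset (fub_Lambda_homo B' _ _ pm) ab.
Qed.

Lemma cu_close_Lambda0 B a b : cu_close (fub_Lambda B 0) a b.
Proof.
move=> g' g; rewrite /fub_Lambda (ub_M0 (fub_uniform_basis B)).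
by move=> [_ ->] [_ ->] _; rewrite !cuHom0.
Qed.

End Closeness.

Local Open Scope ereal_scope.

(** * Balls and inverse radii in the extended reals *)

Section Distance.
Context (R : realType) {d d' : Order.disp_t} {S : cuType d} {T : cuType d'}.
Implicit Types (a b : cuHom S T) (B : fin_uniform_basis S).

Lemma ddCu_ge0 B a b : 0 <= ddCu R B a b.
Proof. by apply: le_ereal_inf_tmp => _ [n _ <-]; rewrite lee_fin invr_ge0. Qed.

(* For [n = 0] the radius is [+oo] and [Lambda_0 = {0}]. *)
Lemma ddCu_leP B a b n :
  ddCu R B a b <= n%:R%:E^-1 <-> cu_close (fub_Lambda B n) a b.
Proof.
case: n => [|n].
  by rewrite inve0 leey; split=> // _; apply: cu_close_Lambda0.
have inv_n1 : (n.+1%:R%:E : \bar R)^-1 = n.+1%:R^-1%:E.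
  by rewrite inver pnatr_eq0.
rewrite inv_n1; split=> [dd_le|ab]; last by apply: ereal_inf_lbound; exists n.+1.
have [k [k0 abk] nk] : exists2 k, (0 < k)%N /\ cu_close (fub_Lambda B k) a b &
    (n < k)%N.
  (* Otherwise only indices [k <= n] compete, and the infimum is at least [1/n > 1/(n+1)], where
     [1/0 = +oo]. *)
  apply: contrapT => noclose.
  have le_n k : (0 < k)%N /\ cu_close (fub_Lambda B k) a b -> (k <= n)%N.
    by move=> abk; rewrite leqNgt; apply/negP => nk; apply: noclose; exists k.
  have : n%:R%:E^-1 <= ddCu R B a b.
    apply: le_ereal_inf_tmp => _ [k abk <-]; have kn := le_n k abk.
    have k0 := abk.1; have n0 := leq_trans k0 kn.
    by rewrite inver pnatr_eq0 gtn_eqF// lee_fin lef_pV2 ?posrE ?ltr0n// ler_nat.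
  move=> /le_trans/(_ dd_le); rewrite -inv_n1 lee_pV2 ?inE ?lee_fin ?ler0n//.
  by rewrite ler_nat ltnn.
exact: cu_close_subset (fub_Lambda_homo B _ _ nk) abk.
Qed.

Lemma q_index_ge0 (B' B : fin_uniform_basis S) n : 0 <= q_index R B' B n.
Proof. by apply: ereal_sup_ubound; exists 0%N => //=; rewrite p_index0. Qed.

Lemma q_index_ge (B' B : fin_uniform_basis S) m n :
  n%:R%:E <= q_index R B' B m ->
  exists2 k, (n <= k)%N & (p_index B' B k <= m)%N.
Proof.
case: n => [_|n nq]; first by exists 0%N => //; rewrite p_index0.
(* The supremum may be infinite or unattained; the strict bound by the predecessor [n] still yields
   a member [k > n]. *)
have [|_ [k pk <-]] := @ereal_sup_gt R _ n%:R%:E (lt_le_trans _ nq).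
  by rewrite lte_fin ltr_nat.
by rewrite lte_fin ltr_nat => nk; exists k.
Qed.

End Distance.

Theorem proposition5p4 (R : realType) (d d' : Order.disp_t)
    (S : cuType d) (hS : uniformly_based S)
    (B B' : fin_uniform_basis S) (T : cuType d') (alpha : cuHom S T)
    (n : nat) (hn : (1 <= n)%N) :
  (forall r'' : \bar R,
     (exists2 m : nat, r''^-1 = m%:R%:E &
                       n%:R%:E <= q_index R B B' m) ->
     closed_ball_Cu (@ddCu R _ _ S T B) alpha r''
       `<=` closed_ball_Cu (@ddCu R _ _ S T B') alpha n%:R%:E^-1) /\
  closed_ball_Cu (@ddCu R _ _ S T B') alpha n%:R%:E^-1
    `<=` closed_ball_Cu (@ddCu R _ _ S T B) alpha (q_index R B' B n)^-1.
Proof.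
split=> [r'' [m r''m nq] beta|beta /ddCu_leP ab]; rewrite /closed_ball_Cu /=.
  (* Inverting twice writes [r''] as the inverse of [m]; the case [m = 0], [r'' = +oo] is
     included. *)
  rewrite -[r'']inveK r''m => /ddCu_leP ab; apply/ddCu_leP.
  have [k nk pk] := q_index_ge _ _ _ _ _ nq.
  apply: cu_close_subset (fub_Lambda_homo B' _ _ nk) _.
  exact: cu_close_p_index pk ab.
(* Moving the inverse to the distance turns the claim into an upper bound on a supremum, checked at
   each [k] even if [q_index] is infinite. *)
rewrite inve_pge ?inE ?ddCu_ge0 ?q_index_ge0//.
apply: ge_ereal_sup => _ [k pk <-].
rewrite inve_pge ?inE ?ddCu_ge0 ?lee_fin ?ler0n//.
by apply/ddCu_leP; apply: cu_close_p_index pk ab.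
Qed.
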